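(* Let $G$ be a finite group and $\Gamma=\mathrm{Cay}(G,S_{i,j}:1\le i,j\le m)$ an $m$-Cayley digraph of $G$. Then $\Gamma$ is K$m$CI if and only if the normalizer $N_{\mathrm{Aut}(\Gamma)}(R(G))$ induces the full symmetric group on $\{G_1,\dots,G_m\}$ and every semiregular subgroup of $\mathrm{Aut}(\Gamma)$ isomorphic to $G$ is conjugate to $R(G)$ in $\mathrm{Aut}(\Gamma)$.
   Context: For subsets $S_{i,j}\subseteq G$, $\mathrm{Cay}(G,S_{i,j}:1\le i,j\le m)$ is the digraph with vertex set $\bigcup_i G_i$, $G_i=\{x_i:x\in G\}$, and arcs $(x_i,(sx)_j)$ for $s\in S_{i,j}$, $x\in G$; these are the $m$-Cayley digraphs of $G$ (on the same vertex set). $R(g):x_i\mapsto(xg)_i$ and $R(G)=\{R(g):g\in G\}\le\mathrm{Aut}(\Gamma)$, with orbits $G_1,\dots,G_m$. A permutation group is semiregular if all point stabilizers are trivial. $N$ is the normalizer of $R(G)$ in the symmetric group on the vertex set and $K$ the kernel of $N$ acting on $\{G_1,\dots,G_m\}$. $\Gamma$ is K$m$CI if for every $m$-Cayley digraph $\Sigma$ of $G$ isomorphic to $\Gamma$ there exists $k\in K$ with $\Gamma^k=\Sigma$. *)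

(* Defs.v *)
From HB Require Import structures.
From mathcomp Require Import all_boot all_fingroup.

Set Implicit Arguments.
Unset Strict Implicit.
Unset Printing Implicit Defensive.

Import GroupScope.

(* A digraph on V is given by its set of arcs; loops are allowed. *)
Definition digraph (V : finType) := {set V * V}.

Section Digraph.

Variable V : finType.
Implicit Types Gam Sig : digraph V.

Definition digraph_isom Gam Sig : Prop :=
  exists f : V -> V,
    bijective f /\ forall u v, ((f u, f v) \in Sig) = ((u, v) \in Gam).

(* The image of Gam under s, written Gam^s in right-action notation. *)
Definition digraph_img Gam (s : {perm V}) : digraph V :=
  [set (s a.1, s a.2) | a in Gam].

Definition digraph_aut Gam : {set {perm V}} :=
  [set s : {perm V} |
    [forall u, forall v, ((s u, s v) \in Gam) == ((u, v) \in Gam)]].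

Lemma digraph_autP Gam (s : {perm V}) :
  reflect (forall u v, ((s u, s v) \in Gam) = ((u, v) \in Gam))
          (s \in digraph_aut Gam).
Proof.
rewrite inE; apply: (iffP forallP) => [h u v | h u].
  by apply/eqP; have /forallP := h u; apply.
by apply/forallP => v; rewrite h.
Qed.

Fact digraph_aut_group_set Gam : group_set (digraph_aut Gam).
Proof.
apply/group_setP; split=> [|s t /digraph_autP hs /digraph_autP ht].
  by apply/digraph_autP => u v; rewrite !perm1.
by apply/digraph_autP => u v; rewrite !permM ht hs.
Qed.

Canonical digraph_aut_group Gam := Group (digraph_aut_group_set Gam).

Definition semiregular_perm (H : {set {perm V}}) : Prop :=
  forall v : V, 'C_H[v | 'P] = 1.

(* The permutation group induced on P by the elements of A that preserve the *)
(* family P of subsets of V is all of Sym(P).                                *)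
Definition induces_Sym (A : {set {perm V}}) (P : {set {set V}}) : Prop :=
  restr_perm P @* (actperm 'P^* @* A) = Sym P.

End Digraph.

Section MCayley.

Variables (gT : finGroupType) (m : nat).

(* The pair (x, i) stands for the vertex x_i. *)
Definition mvertex : finType := (gT * 'I_m)%type.

Definition mCay (S : 'I_m -> 'I_m -> {set gT}) : digraph mvertex :=
  [set a | [exists s in S a.1.2 a.2.2, a.2.1 == s * a.1.1]].

Definition mtrans_fun (g : gT) (v : mvertex) : mvertex := (v.1 * g, v.2).

Fact mtrans_fun_inj g : injective (mtrans_fun g).
Proof. by move=> [x i] [y j] [/mulIg-> ->]. Qed.

Definition mtrans (g : gT) : {perm mvertex} := perm (@mtrans_fun_inj g).

Fact mtransM : {in [set: gT] &, {morph mtrans : g h / g * h}}.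
Proof.
by move=> g h _ _; apply/permP=> v; rewrite permM !permE /mtrans_fun /= mulgA.
Qed.

Canonical mtrans_morphism := Morphism mtransM.

(* The group R(G). *)
Definition RG : {group {perm mvertex}} := (mtrans @* [set: gT])%G.

Definition mblock (i : 'I_m) : {set mvertex} := [set (x, i) | x : gT].

Definition mblocks : {set {set mvertex}} := [set mblock i | i : 'I_m].

(* The kernel K of the action on {G_1, ..., G_m} of the normalizer N of R(G) *)
(* in the full symmetric group.                                              *)
Definition Kker : {set {perm mvertex}} := 'C_('N(RG))(mblocks | 'P^*).

Definition KmCI (Gam : digraph mvertex) : Prop :=
  forall T : 'I_m -> 'I_m -> {set gT},
    digraph_isom Gam (mCay T) ->
    exists2 k, k \in Kker & digraph_img Gam k = mCay T.

End MCayley.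

(* Main.v *)
(** A permutation [f] with [Gam^f = Sig], [Sig] being m-Cayley, pulls [R(G)] back
    to a semiregular copy of [G] inside [Aut Gam], and conversely every such copy
    is conjugate to [R(G)] in the symmetric group, hence arises in this way.
    So conjugacy of these copies in [Aut Gam] says exactly that [f] may be
    corrected by an automorphism to lie in the normalizer [N] of [R(G)]; inducing
    the full symmetric group on the orbits allows a further correction into
    [K]. *)

Require Import Defs.
From HB Require Import structures.
From mathcomp Require Import all_boot all_fingroup.

Set Implicit Arguments.
Unset Strict Implicit.
Unset Printing Implicit Defensive.

Import GroupScope.

(** * Images of digraphs under permutations; semiregular groups *)

Section DigraphImage.

Variable V : finType.
Implicit Types (Gam Sig : digraph V) (s t : {perm V}).

Lemma mem_digraph_img Gam s u v :
  ((s u, s v) \in digraph_img Gam s) = ((u, v) \in Gam).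
Proof.
apply/imsetP/idP => [[[x y] xyG /= [/perm_inj-> /perm_inj->]] //|uvG].
by exists (u, v).
Qed.

Lemma digraph_imgP Gam Sig s :
  reflect (forall u v, ((s u, s v) \in Sig) = ((u, v) \in Gam))
          (digraph_img Gam s == Sig).
Proof.
apply: (iffP eqP) => [<- u v|h]; first exact: mem_digraph_img.
apply/setP=> -[u v]; rewrite -[u](permKV s) -[v](permKV s).
by rewrite mem_digraph_img h.
Qed.

Lemma digraph_imgM Gam s t :
  digraph_img Gam (s * t) = digraph_img (digraph_img Gam s) t.
Proof.
by apply/eqP/digraph_imgP => u v; rewrite !permM !mem_digraph_img.
Qed.

Lemma digraph_img1 Gam : digraph_img Gam 1 = Gam.
Proof. by apply/eqP/digraph_imgP => u v; rewrite !perm1. Qed.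

Lemma digraph_aut_img Gam s :
  (s \in digraph_aut Gam) = (digraph_img Gam s == Gam).
Proof. by apply/digraph_autP/digraph_imgP. Qed.

Lemma digraph_imgV_aut Gam s t :
  digraph_img Gam s = digraph_img Gam t -> s * t^-1 \in digraph_aut Gam.
Proof.
by rewrite digraph_aut_img digraph_imgM => ->; rewrite -digraph_imgM mulgV digraph_img1.
Qed.

Lemma digraph_autJ Gam s t :
  (t ^ s \in digraph_aut (digraph_img Gam s)) = (t \in digraph_aut Gam).
Proof.
apply/digraph_autP/digraph_autP => h u v.
  by rewrite -(mem_digraph_img Gam s) -(permJ t s u) -(permJ t s v) h mem_digraph_img.
rewrite -[u](permKV s) -[v](permKV s) !permJ !mem_digraph_img.
exact: h.
Qed.

Lemma digraph_aut_imgE Gam s :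
  digraph_aut (digraph_img Gam s) = digraph_aut Gam :^ s.
Proof.
by apply/setP=> t; rewrite mem_conjg -{1}(conjgKV s t) digraph_autJ.
Qed.

Lemma digraph_isom_perm Gam Sig :
  digraph_isom Gam Sig <-> exists s, digraph_img Gam s = Sig.
Proof.
split=> [[f [/bij_inj f_inj h]]|[s /eqP/digraph_imgP h]].
  by exists (perm f_inj); apply/eqP/digraph_imgP => u v; rewrite !permE.
by exists s; split=> //; exists (s^-1 : {perm V}) => x; rewrite ?permK ?permKV.
Qed.

Lemma semiregular_permP (H : {group {perm V}}) :
  semiregular_perm H <-> forall h v, h \in H -> h v = v -> h = 1.
Proof.
split=> [sr h v hH hv|sr v].
  have : h \in 'C_H[v | 'P] by rewrite inE hH; apply/astab1P.
  by rewrite sr => /set1P.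
apply/eqP; rewrite eqEsubset sub1G andbT; apply/subsetP=> h /setIP[hH /astab1P hv].
by apply/set1P; apply: sr hv.
Qed.

Lemma semiregular_permJ (H : {group {perm V}}) s :
  semiregular_perm H -> semiregular_perm (H :^ s).
Proof.
move=> /semiregular_permP sr; apply/(semiregular_permP (H :^ s)%G) => h v.
rewrite mem_conjg => hH hv; rewrite -(conjgKV s h).
rewrite (sr _ (s^-1 v) hH) ?conj1g //.
by rewrite permJ hv.
Qed.

Lemma card_semiregular_orbit (H : {group {perm V}}) v :
  semiregular_perm H -> #|orbit 'P H v| = #|H|.
Proof. by move=> sr; rewrite card_orbit sr indexg1. Qed.

End DigraphImage.

(** * Translations, m-Cayley digraphs and semiregular copies of the group *)

Section MCayleyTheory.

Variables (gT : finGroupType) (m : nat).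

Local Notation V := (mvertex gT m).
Local Notation R := (RG gT m).
Local Notation blocks := (mblocks gT m).

Implicit Types (Gam : digraph V) (s n : {perm V}) (H : {group {perm V}}).

Lemma mtransE g (v : V) : mtrans m g v = (v.1 * g, v.2).
Proof. by rewrite permE. Qed.

Lemma mem_RG g : mtrans m g \in R.
Proof. by rewrite mem_morphim ?inE. Qed.

Lemma RGP s : reflect (exists g, s = mtrans m g) (s \in R).
Proof.
by apply: (iffP morphimP) => [[g _ _ ->]|[g ->]]; exists g; rewrite ?inE.
Qed.

Lemma mem_mCay (S : 'I_m -> 'I_m -> {set gT}) (u v : V) :
  ((u, v) \in mCay S) = (v.1 * u.1^-1 \in S u.2 v.2).
Proof.
rewrite inE /=; apply/exists_inP/idP => [[s sS /eqP->]|h]; first by rewrite mulgK.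
by exists (v.1 * u.1^-1); rewrite ?mulgKV.
Qed.

Lemma RG_sub_aut_mCay (S : 'I_m -> 'I_m -> {set gT}) :
  R \subset digraph_aut (mCay S).
Proof.
apply/subsetP=> _ /RGP[g ->]; apply/digraph_autP => u v.
by rewrite !mem_mCay !mtransE /= invMg mulgA mulgK.
Qed.

(** The connection sets are read off the arcs leaving the vertices [(1, i)]; translation by [x]
    carries these to the arcs leaving [(x, i)]. *)
Lemma mCay_of_RG_sub_aut Gam :
  R \subset digraph_aut Gam -> exists T, Gam = mCay T.
Proof.
move=> sRA; exists (fun i j => [set s | ((1, i), (s, j)) \in Gam]).
apply/setP=> -[[x i] [y j]]; rewrite mem_mCay inE /=.
have /digraph_autP h := subsetP sRA _ (mem_RG x).
by rewrite -[RHS]h !mtransE /= mul1g mulgKV.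
Qed.

Lemma semiregular_RG : semiregular_perm R.
Proof.
apply/semiregular_permP => _ v /RGP[g ->]; rewrite mtransE => -[].
move=> /(congr1 fst) /= /(canRL (mulKg _)); rewrite mulVg => ->.
exact: morph1.
Qed.

Lemma isog_RG : 0 < m -> R \isog [set: gT].
Proof.
move=> m_gt0; rewrite isog_sym; apply: sub_isog => //.
(* Faithfulness is tested at one vertex, which exists because [0 < m]. *)
apply/injmP=> g h _ _ /permP/(_ (1, Ordinal m_gt0)).
by rewrite !mtransE /= !mul1g => -[].
Qed.

(** Choose a representative [t i] in each orbit of [H] and an isomorphism [phi] from the group to
    [H]. Sending [(x, i)] to [phi x (t i)] is a bijection that turns right translation by [g] into
    [phi g]. *)
Lemma semiregular_isog_conj_RG H :
  semiregular_perm H -> H \isog [set: gT] -> exists s, R :^ s = H.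
Proof.
move=> sr; rewrite isog_sym => isoH; have cardH := card_isog isoH.
have /isogP[phi /injmP phi_inj imphi] := isoH.
have phiH x : phi x \in H by rewrite -imphi mem_morphim ?inE.
set X := orbit_transversal 'P H [set: V].
have actsH : [acts H, on [set: V] | 'P] by apply/actsP=> a _ x; rewrite !inE.
have [trX _ X_orb _] := orbit_transversalP actsH.
(* All orbits have size [#|H| = #|gT|], and the vertex set has [#|gT| * m] elements. *)
have cardX : #|X| = m.
  have unif : {in orbit 'P H @: [set: V], forall B : {set V}, #|B| = #|H|}.
    by move=> _ /imsetP[v _ ->]; rewrite card_semiregular_orbit.
  have := card_uniform_partition unif (orbit_partition actsH).
  rewrite -(card_transversal trX) cardsT card_prod card_ord -cardH cardsT mulnC.
  have G_gt0 : 0 < #|gT| by rewrite -cardsT cardG_gt0.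
  by move/eqP; rewrite eqn_pmul2r // => /eqP.
pose t (i : 'I_m) : V := enum_val (cast_ord (esym cardX) i).
pose f (v : V) : V := phi v.1 (t v.2).
have f_inj : injective f.
  move=> [x i] [y j]; rewrite /f /= => e.
  (* Hence [t i] and [t j] share an orbit, so [i = j]; semiregularity then gives [phi x = phi y]. *)
  have e' : (phi x * (phi y)^-1) (t i) = t j by rewrite permM e permK.
  have ij : i = j.
    have : t i == t j.
      rewrite -X_orb ?enum_valP // -e'.
      by apply/orbitP; exists (phi x * (phi y)^-1); rewrite ?groupM ?groupV.
    by move/eqP/enum_val_inj/cast_ord_inj.
  rewrite -ij in e'; congr pair => //; apply: phi_inj; rewrite ?inE //.
  move/semiregular_permP: sr => /(_ _ (t i) _ e') h; apply/eqP.
  by rewrite eq_mulgV1 h ?groupM ?groupV.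
have conj_f g : mtrans m g ^ perm f_inj = phi g.
  apply/permP=> v; rewrite -[v](permKV (perm f_inj)) permJ !permE /f /=.
  by rewrite morphM ?inE // permM.
exists (perm f_inj); apply/setP=> h; rewrite mem_conjg -imphi.
apply/RGP/morphimP => [[g e]|[g _ _ ->]].
  by exists g; rewrite ?inE // -conj_f -e conjgKV.
by exists g; rewrite -conj_f conjgK.
Qed.

(** * Action of the normalizer of the translations on the blocks *)

Lemma norm_RG_block n x i : n \in 'N(R) -> (n (x, i)).2 = (n (1, i)).2.
Proof.
move=> nR; have -> : (x, i) = mtrans m x (1, i) :> V by rewrite mtransE mul1g.
(* The conjugate of a translation by [n] is again a translation, which leaves the index
   unchanged. *)
have /RGP[y ey] : mtrans m x ^ n \in R by rewrite memJ_norm ?mem_RG.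
by rewrite -permJ ey mtransE.
Qed.

Lemma mem_mblock (v : V) i : (v \in mblock gT i) = (v.2 == i).
Proof.
apply/imsetP/eqP => [[x _ ->] //|<-].
by exists v.1; rewrite ?inE //; case: v.
Qed.

Lemma mblock_inj : injective (@mblock gT m).
Proof.
by move=> i j e; have := mem_mblock (1, i) j; rewrite -e mem_mblock eqxx => /esym/eqP.
Qed.

Lemma mblock_in (i : 'I_m) : mblock gT i \in blocks.
Proof. exact: imset_f. Qed.

Lemma card_mblock (i : 'I_m) : #|mblock gT i| = #|gT|.
Proof. by rewrite card_imset // => x y []. Qed.

Lemma setact_mblock n i :
  n \in 'N(R) -> 'P^*%act (mblock gT i) n = mblock gT (n (1, i)).2.
Proof.
move=> nR; apply/eqP; rewrite eqEcard card_setact !card_mblock leqnn andbT.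
apply/subsetP=> _ /imsetP[[x j] + ->].
by rewrite !mem_mblock /= => /eqP->; rewrite apermE norm_RG_block.
Qed.

Lemma norm_RG_block_inj n :
  n \in 'N(R) -> injective (fun i : 'I_m => (n (1, i)).2).
Proof.
move=> nR i j e; apply/mblock_inj/(act_inj 'P^* n).
by rewrite !setact_mblock // e.
Qed.

(** These maps commute with all translations and show that the full normalizer realizes every
    permutation of the blocks. *)
Definition block_perm_fun (p : {perm 'I_m}) (v : V) : V := (v.1, p v.2).

Fact block_perm_fun_inj p : injective (block_perm_fun p).
Proof. by move=> [x i] [y j] [-> /perm_inj->]. Qed.

Definition block_perm p : {perm V} := perm (@block_perm_fun_inj p).

Lemma block_permE p (v : V) : block_perm p v = (v.1, p v.2).
Proof. by rewrite permE. Qed.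

Lemma block_perm_norm p : block_perm p \in 'N(R).
Proof.
rewrite inE; apply/subsetP=> s; rewrite mem_conjg => /RGP[g e].
apply/RGP; exists g; rewrite -(conjgKV (block_perm p) s) e.
apply/permP=> v; rewrite -[v](permKV (block_perm p)) permJ.
by rewrite !(mtransE, block_permE).
Qed.

Lemma norm_RG_stab_blocks n : n \in 'N(R) -> actperm 'P^* n \in 'N(blocks | 'P).
Proof.
move=> nR; apply/setIP; split; rewrite inE //; apply/subsetP=> _ /imsetP[i _ ->].
by rewrite inE /= apermE actpermE setact_mblock // mblock_in.
Qed.

Lemma restr_norm_RG_mblock n i : n \in 'N(R) ->
  restr_perm blocks (actperm 'P^* n) (mblock gT i) = mblock gT (n (1, i)).2.
Proof.
by move=> nR; rewrite restr_permE ?norm_RG_stab_blocks ?mblock_in // actpermE setact_mblock.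
Qed.

(** Since [mblock] is injective, permutations of the family of blocks amount to permutations of the
    indices. *)
Lemma induces_Sym_normP (A : {group {perm V}}) :
  A \subset 'N(R) ->
  induces_Sym A blocks <->
  forall p : {perm 'I_m}, exists2 a, a \in A & forall i, (a (1, i)).2 = p i.
Proof.
move=> sAN; have nA a : a \in A -> a \in 'N(R) by apply: (subsetP sAN).
split=> [indA p|h].
  have : restr_perm blocks (actperm 'P^* (block_perm p)) \in Sym blocks.
    by rewrite inE restr_perm_on.
  rewrite -indA => /morphimP[_ _ /morphimP[a _ aA ->] e].
  exists a => // i; apply: mblock_inj.
  rewrite -restr_norm_RG_mblock ?nA // -e restr_norm_RG_mblock ?block_perm_norm //.
  by rewrite block_permE.
apply/setP=> q; apply/idP/idP => [/morphimP[b _ _ ->]|].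
  by rewrite inE restr_perm_on.
rewrite inE => qP.
(* Transport [q] to a map [f] on indices, which is then realized by an element of [A]. *)
have /fin_all_exists[f fE] i : exists j, q (mblock gT i) = mblock gT j.
  have : q (mblock gT i) \in blocks by rewrite perm_closed ?mblock_in.
  by case/imsetP=> j _ ->; exists j.
have f_inj : injective f.
  by move=> i j e; apply/mblock_inj/(@perm_inj _ q); rewrite !fE e.
have [a aA aE] := h (perm f_inj).
have -> : q = restr_perm blocks (actperm 'P^* a).
  apply/permP=> B; have [/imsetP[i _ ->]|nB] := boolP (B \in blocks).
    by rewrite restr_norm_RG_mblock ?nA // aE permE fE.
  by rewrite !(out_perm _ nB) // restr_perm_on.
by rewrite mem_morphim ?norm_RG_stab_blocks ?nA // mem_morphim ?inE.
Qed.

Lemma KkerP k :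
  reflect (k \in 'N(R) /\ forall i, (k (1, i)).2 = i) (k \in Kker gT m).
Proof.
apply: (iffP setIP) => -[kN h]; split=> //.
  move=> i; apply: mblock_inj; rewrite -setact_mblock //.
  exact: (astabP h) (mblock_in i).
by apply/astabP=> _ /imsetP[i _ ->]; rewrite setact_mblock // h.
Qed.

Lemma Kker_block k (v : V) : k \in Kker gT m -> (k v).2 = v.2.
Proof.
by case: v => x i /KkerP[kN kE]; rewrite norm_RG_block // kE.
Qed.

End MCayleyTheory.

(** * Correction by the kernel versus conjugacy in the automorphism group *)

Theorem theorem2p3 (gT : finGroupType) (m : nat) (hm : (0 < m)%N)
    (S : 'I_m -> 'I_m -> {set gT}) :
  KmCI (mCay S) <->
  (induces_Sym 'N_(digraph_aut (mCay S))(RG gT m) (mblocks gT m) /\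
   forall H : {group {perm mvertex gT m}},
     H \subset digraph_aut (mCay S) ->
     semiregular_perm H ->
     H \isog [set: gT] ->
     exists2 a, a \in digraph_aut (mCay S) & H :^ a = RG gT m).
Proof.
set Gam := mCay S; set R := RG gT m; set A := digraph_aut Gam.
have indP := @induces_Sym_normP gT m ('N_A(R))%G (subsetIr _ _).
split=> [ci|[/indP ind conj] T /digraph_isom_perm[f fT]].
  (* The assumption says that [R] lies in the automorphism group of the image of [Gam] under [s].
     That image is thus m-Cayley, and the K[m]CI property gives a [k] with the same image. *)
  have Kcorrect s : R :^ s^-1 \subset A ->
      exists2 k, k \in Kker gT m & s * k^-1 \in A.
    move=> sRA; have [T eT] : exists T, digraph_img Gam s = mCay T.
      by apply: mCay_of_RG_sub_aut; rewrite digraph_aut_imgE -sub_conjgV.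
    have [|k kK ek] := ci T; first by apply/digraph_isom_perm; exists s.
    by exists k => //; apply: digraph_imgV_aut; rewrite eT ek.
  split=> [|H sHA sr isoH].
    apply/indP => p; have pN := block_perm_norm gT p.
    (* Multiplying by [k^-1] gives an automorphism without changing the permutation of the
       blocks. *)
    have [|k kK aA] := Kcorrect (block_perm gT p).
      by rewrite (normP _) ?groupV // RG_sub_aut_mCay.
    have /KkerP[kN _] := kK.
    exists (block_perm gT p * k^-1); first by rewrite inE aA groupM ?groupV.
    by move=> i; rewrite permM -(Kker_block _ kK) permKV block_permE.
  have [s Rs] := semiregular_isog_conj_RG sr isoH.
  (* [s^-1] conjugates [H] to [R], and [k] normalizes [R], so the product still does. *)
  have [|k /KkerP[kN _] aA] := Kcorrect s^-1; first by rewrite invgK Rs.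
  exists (s^-1 * k^-1) => //.
  by rewrite -Rs conjsgM conjsgK (normP _) ?groupV.
have sRT : R :^ f^-1 \subset A.
  by rewrite sub_conjgV -digraph_aut_imgE fT RG_sub_aut_mCay.
have [||a aA aR] := conj (R :^ f^-1)%G sRT.
- exact/semiregular_permJ/semiregular_RG.
- apply: isog_trans (isog_RG _ hm).
  by rewrite isog_sym conj_isog.
(* As [a] conjugates [R :^ f^-1] to [R], [n] normalizes [R]; as [a] is an automorphism, [n] and [f]
   have the same effect on [Gam]. *)
pose n := a^-1 * f.
have nN : n \in 'N(R).
  by rewrite -groupV invMg invgK; apply/normP; rewrite conjsgM.
have nT : digraph_img Gam n = mCay T.
  rewrite digraph_imgM -fT; congr digraph_img; apply/eqP.
  by rewrite -digraph_aut_img groupV.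
(* [b] is an automorphism in the normalizer that permutes the blocks as [n] does, so [b^-1 * n]
   fixes each block. *)
have [b /setIP[bA bN] bE] := ind (perm (norm_RG_block_inj nN)).
have nb w : (n w).2 = (b w).2.
  case: w => x j; rewrite (norm_RG_block x j nN) (norm_RG_block x j bN).
  by rewrite bE [RHS]permE.
exists (b^-1 * n).
  apply/KkerP; split=> [|i]; first by rewrite groupM ?groupV.
  by rewrite permM nb permKV.
rewrite digraph_imgM -nT; congr digraph_img; apply/eqP.
by rewrite -digraph_aut_img groupV.
Qed.
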